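(* Fix any $c>1/e$ and $d\ge0$. For all sufficiently large $T$, there exists $V$ such that for every probability distribution $P_{T,V}$ over protocols in $\tilde\Pi_{T,V}$, there exists a type $\mathbf v\in\tilde{\mathcal V}_{T,V}$ with $\mathbb E_{\pi\sim P_{T,V}}[{\sf Rev}_\pi(\mathbf v)]\le cV-d$.
   Context: Single-buyer game over $T$ rounds with known total value. Let $\varepsilon_T=T^{-100}$. $\tilde{\mathcal V}_{T,V}$ is the (finite) set of types $\mathbf v=(v_1,\dots,v_T)$ with each $v_t\in[0,1]$ an integer multiple of $\varepsilon_T$ and $\sum_tv_t=V$. A protocol over $\tilde{\mathcal V}_{T,V}$ specifies for each $\mathbf v$ allocations $r_{\mathbf v,t}\in[0,1]$, prices $x_{\mathbf v,t}$ and a reimbursement $g_{\mathbf v}$ (buyer receives $r_{\mathbf v,t}$ in round $t$, must pay $x_{\mathbf v,t}$ or be eliminated, and gets $g_{\mathbf v}$ at the end). It is $\varepsilon_T$-discrete if all $r,x,g$ values are multiples of $\varepsilon_T$, and $\varepsilon_T$-truthful if $x_{\mathbf v,t}\le r_{\mathbf v,t}v_t+10\varepsilon_T$ for all $\mathbf v,t$, and for all $\mathbf v,\mathbf v'\in\tilde{\mathcal V}_{T,V}$ and $\tau\le T$ with $x_{\mathbf v',t}\le r_{\mathbf v',t}v_t+10\varepsilon_T$ for all $t\le\tau$: $\sum_{t=1}^T(r_{\mathbf v,t}v_t-x_{\mathbf v,t})+g_{\mathbf v}\ge\sum_{t=1}^\tau(r_{\mathbf v',t}v_t-x_{\mathbf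 v',t})+g_{\mathbf v'}\mathbf 1(\tau=T)-10\varepsilon_TT$. $\tilde\Pi_{T,V}$ is the set of $\varepsilon_T$-discrete, $\varepsilon_T$-truthful protocols over $\tilde{\mathcal V}_{T,V}$. Revenue is ${\sf Rev}_\pi(\mathbf v)=\sum_tx_{\mathbf v,t}-g_{\mathbf v}$. *)

(* Defs.v *)
From HB Require Import structures.
From mathcomp Require Import all_boot all_order all_algebra.
From mathcomp Require Import all_classical all_reals.
From mathcomp Require Import ereal esum.
From mathcomp Require Import sequences.
From mathcomp.analysis Require Import exp.
Set Implicit Arguments. Unset Strict Implicit. Unset Printing Implicit Defensive.
Import Order.TTheory GRing.Theory Num.Theory.
Local Open Scope ring_scope.

Definition Ngrid (T : nat) : nat := (T ^ 100)%N.

Definition epsT (R : realType) (T : nat) : R := ((T%:R) ^+ 100)^-1.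

Section Game.
Variables (R : realType) (T : nat) (V : R).

Definition Ty : finType :=
  {k : {ffun 'I_T -> 'I_(Ngrid T).+1} |
     (\sum_(t < T) ((val (k t))%:R * epsT R T)) == V}.

Definition val_t (v : Ty) (t : 'I_T) : R := (val (val v t))%:R * epsT R T.

(* A protocol over Ty, eps_T-discrete by construction: its allocations,
   prices and reimbursement are integer multiples of eps_T, encoded by the
   integer coefficients (r, x, g). *)
Definition Proto : countType :=
  ({ffun Ty -> {ffun 'I_T -> int}} * {ffun Ty -> {ffun 'I_T -> int}}
   * {ffun Ty -> int})%type.

Definition alloc (pi : Proto) (v : Ty) (t : 'I_T) : R := (pi.1.1 v t)%:~R * epsT R T.
Definition price (pi : Proto) (v : Ty) (t : 'I_T) : R := (pi.1.2 v t)%:~R * epsT R T.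
Definition reimb (pi : Proto) (v : Ty) : R := (pi.2 v)%:~R * epsT R T.

Definition truthful (pi : Proto) : Prop :=
  (forall v t, 0 <= alloc pi v t <= 1) /\
  (forall v t, price pi v t <= alloc pi v t * val_t v t + 10 * epsT R T) /\
  (forall (v v' : Ty) (tau : nat), (tau <= T)%N ->
     (forall t : 'I_T, (t < tau)%N ->
         price pi v' t <= alloc pi v' t * val_t v t + 10 * epsT R T) ->
     \sum_(t < T) (alloc pi v t * val_t v t - price pi v t) + reimb pi v >=
     \sum_(t < T | (t < tau)%N) (alloc pi v' t * val_t v t - price pi v' t)
       + (if tau == T then reimb pi v' else 0) - 10 * epsT R T * T%:R).

Definition Rev (pi : Proto) (v : Ty) : R :=
  \sum_(t < T) price pi v t - reimb pi v.

Definition is_distr (p : Proto -> R) : Prop :=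
  (forall pi, 0 <= p pi) /\ (forall pi, p pi != 0 -> truthful pi) /\
  (\esum_(pi in [set: Proto]) (p pi)%:E = 1)%E.

(* E_{pi ~ p}[Rev_pi(v)] in the extended reals (positive part minus
   negative part; the value may be -oo). *)
Definition ExpRev (p : Proto -> R) (v : Ty) : \bar R :=
  (\esum_(pi in [set: Proto]) (Num.max (p pi * Rev pi v) 0)%:E
   - \esum_(pi in [set: Proto]) (Num.max (- (p pi * Rev pi v)) 0)%:E)%E.

End Game.

(* Main.v *)
(* By Yao's principle it suffices to find one distribution over types against
   which every truthful protocol has small expected revenue.  Normalise the total
   value to 1, and call b achieved at nu when some finite distribution of value
   profiles forces E[welfare - nu * utility] <= b.  The value 1 is achieved at
   nu = 0, and revenue is the case nu = 1.  Given distributions A at nu and B at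
   nu + kap, make all types earn a small value th in a first block, at the expected
   rate of A; then with probability q the remaining 1 - th arrives inside that block
   following A ("fast"), and otherwise it arrives later following B ("slow").
   A fast type can follow a slow contract through the block and leave, so what the
   seller allocates to slow types during the block is paid for in utility of fast
   types; q is chosen so that the two effects cancel.  Letting th tend to 0, the
   infimum beta of the achieved values satisfies
   beta (nu + kap) <= beta nu / (1 + kap), hence beta 1 <= (1 + 1/N)^(-N) -> 1/e.
   All data are kept rational so that a fixed distribution can be rescaled to the
   grid of mesh T^(-100) for every large T. *)
Require Import Defs.
From HB Require Import structures.
From mathcomp Require Import all_boot all_order all_algebra.
From mathcomp Require Import ring lra.
From mathcomp Require Import all_classical all_reals.
From mathcomp Require Import ereal esum.
From mathcomp Require Import sequences.
From mathcomp.analysis Require Import exp.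
Import Order.TTheory GRing.Theory Num.Theory.
Local Open Scope ring_scope.

Section HardGames.
Context {R : realType}.
Implicit Types (I : finType) (h a b nu kap th q : R).

(** * Rational elements of [R] *)

Lemma rational_rat (q : rat) : rational (ratr q : R).
Proof. by exists q. Qed.

Lemma rational_nat n : rational (n%:R : R).
Proof. by exists n%:R=> //; rewrite ratr_nat. Qed.

Lemma rationalD (x y : R) : rational x -> rational y -> rational (x + y).
Proof. by move=> [a _ <-] [b _ <-]; exists (a + b) => //; rewrite rmorphD. Qed.

Lemma rationalN (x : R) : rational x -> rational (- x).
Proof. by move=> [a _ <-]; exists (- a) => //; rewrite rmorphN. Qed.

Lemma rationalM (x y : R) : rational x -> rational y -> rational (x * y).
Proof. by move=> [a _ <-] [b _ <-]; exists (a * b) => //; rewrite rmorphM. Qed.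

Lemma rationalV (x : R) : rational x -> rational x^-1.
Proof. by move=> [a _ <-]; exists a^-1 => //; rewrite fmorphV. Qed.

Lemma rational_sum I (F : I -> R) :
  (forall i, rational (F i)) -> rational (\sum_i F i).
Proof.
by move=> rF; elim/big_ind: _ => //; [exact: (rational_nat 0)|exact: rationalD].
Qed.

(* Prices are eliminated: since x_j <= r_j v_j, a type i with v_i >= v_j up to tau
   can follow the contract of j until tau and gains at least r_j (v_i - v_j) in each
   round.  Here U is the utility, up to an additive slack absorbing the O(eps_T)
   terms. *)
Definition incentive I (L : nat) (v r : I -> nat -> R) (U : I -> R) :=
  forall i j (tau : nat), (tau <= L)%N ->
    (forall t, (t < tau)%N -> v j t <= v i t) ->
    \sum_(t < tau) r j t * (v i t - v j t) <= U i.

Definition hard I (L : nat) (p : I -> R) (v : I -> nat -> R) nu b :=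
  forall r U, (forall i t, 0 <= r i t <= 1) -> incentive I L v r U ->
    \sum_i p i * (\sum_(t < L) r i t * v i t - nu * U i) <= b.

(* The bound h on the values allows a large total once they are rescaled to [0, 1]. *)
Definition prior I (L : nat) (p : I -> R) (v : I -> nat -> R) h :=
  [/\ forall i, 0 <= p i /\ rational (p i), \sum_i p i = 1,
      forall i t, 0 <= v i t <= h /\ rational (v i t) &
      forall i, \sum_(t < L) v i t = 1].

Definition achieved h nu b := exists I (L : nat) (p : I -> R) v,
  prior I L p v h /\ hard I L p v nu b.

(** * Basic achieved values *)

Lemma incentive_ge0 I L v r U i : incentive I L v r U -> 0 <= U i.
Proof. by move=> /(_ i i 0 isT)/= H; apply: le_trans (H _) => //; rewrite big_ord0. Qed.

(** Zero allocations with zero utilities satisfy the constraints and yield 0. This bounds the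
    infimum [beta] from below. *)
Lemma achieved_ge0 h nu b : achieved h nu b -> 0 <= b.
Proof.
move=> [I [L [p [v [_ hd]]]]].
have := hd (fun _ _ => 0) (fun _ => 0).
rewrite big1; last first.
  by move=> i _; rewrite big1 ?mulr0 ?subr0 ?mulr0// => t _; rewrite mul0r.
apply=> [i t|i j tau _ _]; first by rewrite lexx ler01.
by rewrite big1// => t _; rewrite mul0r.
Qed.

Lemma achieved_weaken h nu kap b : 0 <= kap ->
  achieved h nu b -> achieved h (nu + kap) b.
Proof.
move=> k0 [I [L [p [v [[p0 p1 vh v1] hd]]]]].
exists I, L, p, v; split=> // r U r01 inc.
apply: le_trans (hd r U r01 inc); apply: ler_sum => i _.
apply: ler_wpM2l; first by case: (p0 i).
by rewrite lerB// mulrDl lerDl mulr_ge0// (incentive_ge0 _ _ _ _ _ _ inc).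
Qed.

(** At [nu = 0] only welfare counts, and it never exceeds the total value. A single flat profile
    over [n.+1] rounds respects the bound [h]. *)
Lemma achieved_base h (n : nat) : n.+1%:R^-1 <= h -> achieved h 0 1.
Proof.
move=> nh; exists unit, n.+1, (fun _ => 1), (fun _ _ => n.+1%:R^-1).
have v1 : \sum_(t < n.+1) n.+1%:R^-1 = 1 :> R.
  by rewrite sumr_const card_ord -[LHS]mulr_natr mulVf ?pnatr_eq0.
split.
  split=> //.
  - by move=> _; split=> //; exact: (rational_nat 1).
  - by rewrite (big_pred1 tt) => [//|[]].
  - by move=> _ _; split; [rewrite nh invr_ge0 ler0n|exact/rationalV/rational_nat].
move=> r U r01 _; rewrite (big_pred1 tt) => [|[]//]; rewrite mul1r mul0r subr0 -[leRHS]v1.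
apply: ler_sum => t _; case/andP: (r01 tt t) => _ r1.
by rewrite ler_piMl// invr_ge0 ler0n.
Qed.

(** * Combining two games into one *)

Lemma achieved_step h nu kap a b th q : 0 <= h -> 0 <= kap ->
  0 < th < 1 -> 0 <= q <= 1 -> rational th -> rational q ->
  (1 - q) * th = kap * q * (1 - th) ->
  achieved h nu a -> achieved h (nu + kap) b ->
  achieved h (nu + kap)
    (q * (th + (1 - th) * a) + (1 - q) * ((1 - th) * b)).
Proof.
move=> h0 k0 /andP[th0 th1] /andP[q0 q1] rth rq eq_marginal.
move=> [I [L [p [v [[p0 p1 vh v1] hdA]]]]].
move=> [J [M [p' [w [[p'0 p'1 wh w1] hdB]]]]].
have th'0 : 0 < 1 - th by rewrite subr_gt0.
have rth' : rational (1 - th).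
  by apply: rationalD; [exact: (rational_nat 1)|exact: rationalN].
have q'0 : 0 <= 1 - q by rewrite subr_ge0.
have rq' : rational (1 - q).
  by apply: rationalD; [exact: (rational_nat 1)|exact: rationalN].
(* With the mean profile as common part, the gain of fast types from following a slow contract
   averages to a multiple of the slow welfare in the block. *)
pose mu t := \sum_i p i * v i t.
have muh t : 0 <= mu t <= h.
  apply/andP; split; first by apply: sumr_ge0 => i _;
    apply: mulr_ge0; [case: (p0 i)|case: (vh i t) => /andP[]].
  have -> : h = \sum_i p i * h by rewrite -mulr_suml p1 mul1r.
  apply: ler_sum => i _.
  by apply: ler_wpM2l; [case: (p0 i)|case: (vh i t) => /andP[]].
have rmu t : rational (mu t).
  by apply: rational_sum => i; apply: rationalM; [case: (p0 i)|case: (vh i t)].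
have mu1 : \sum_(t < L) mu t = 1.
  rewrite exchange_big /= -p1; apply: eq_bigr => i _.
  by rewrite -mulr_sumr v1 mulr1.
pose z (k : I + J) (t : nat) := match k with
  | inl i => if (t < L)%N then th * mu t + (1 - th) * v i t else 0
  | inr j => if (t < L)%N then th * mu t else (1 - th) * w j (t - L)%N end.
pose pz (k : I + J) := match k with
  | inl i => q * p i | inr j => (1 - q) * p' j end.
have zl i t : (t < L)%N -> z (inl i) t = th * mu t + (1 - th) * v i t.
  by move=> /= ->.
have zr j t : (t < L)%N -> z (inr j) t = th * mu t by move=> /= ->.
have zr' j t : z (inr j) (L + t)%N = (1 - th) * w j t.
  by rewrite /= ltnNge leq_addr /= addKn.
have zl' i t : z (inl i) (L + t)%N = 0 by rewrite /= ltnNge leq_addr.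
have split_sum n (F : nat -> R) :
    \sum_(t < L + n) F t = \sum_(t < L) F t + \sum_(t < n) F (L + t)%N.
  by rewrite big_split_ord.
exists (I + J)%type, (L + M)%N, pz, z; split.
  split.
  - case=> [i|j] /=; [case: (p0 i)|case: (p'0 j)] => ? ?;
      by split; [exact: mulr_ge0|exact: rationalM].
  - by rewrite big_sumType /= -!mulr_sumr p1 p'1 !mulr1 subrKC.
  - move=> k t; have [/andP[m0 mh] rm] := (muh t, rmu t); case: k => [i|j] /=.
      case: ifP => _; last first.
        by rewrite lexx h0; split=> //; exact: (rational_nat 0).
      have [/andP[v0 vh'] rv] := vh i t.
      split; last by apply: rationalD; exact: rationalM.
      apply/andP; split; first by apply: addr_ge0; apply: mulr_ge0 => //; exact: ltW.
      nra.
    case: ifP => _; first by split; [nra|exact: rationalM].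
    have [/andP[v0 vh'] rv] := wh j (t - L)%N.
    by split; [nra|exact: rationalM].
  - case=> [i|j]; rewrite split_sum.
      rewrite (eq_bigr (fun t : 'I_L => th * mu t + (1 - th) * v i t)); last first.
        by move=> t _; rewrite zl.
      rewrite big_split /= -!mulr_sumr mu1 v1 [X in _ + X]big1 ?addr0 => [|t _].
        by rewrite !mulr1 subrKC.
      by rewrite ltnNge leq_addr.
    rewrite (eq_bigr (fun t : 'I_L => th * mu t)); last by move=> t _; rewrite zr.
    rewrite [X in _ + X](eq_bigr (fun t : 'I_M => (1 - th) * w j t)); last first.
      by move=> t _; rewrite zr'.
    by rewrite -!mulr_sumr mu1 w1 !mulr1 subrKC.
move=> r U r01 inc.
(* The common part [th * mu] cancels between fast types, so their constraints are those of the first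
   game scaled by [1 - th]. *)
have SA : \sum_i p i * (\sum_(t < L) r (inl i) t * v i t
      - nu * (U (inl i) / (1 - th))) <= a.
  apply: (hdA (fun i => r (inl i)) (fun i => U (inl i) / (1 - th))) => //.
  move=> i i' tau tauL le_v; rewrite ler_pdivlMr// mulr_suml.
  apply: le_trans (inc (inl i) (inl i') tau _ _); first last.
  - move=> t tt; have tL := leq_trans tt tauL.
    by rewrite !zl// lerD2l; apply: ler_wpM2l; [exact: ltW|exact: le_v].
  - exact: leq_trans tauL (leq_addr _ _).
  - apply: ler_sum => t _; rewrite !zl ?(leq_trans (ltn_ord t))//.
    lra.
(* Slow types coincide on the block, so deviations between them gain only after it. *)
have SB : \sum_j p' j * (\sum_(t < M) r (inr j) (L + t)%N * w j t
      - (nu + kap) * (U (inr j) / (1 - th))) <= b.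
  apply: (hdB (fun j t => r (inr j) (L + t)%N) (fun j => U (inr j) / (1 - th))) => //.
  move=> i i' tau tauL le_w; rewrite ler_pdivlMr// mulr_suml.
  apply: le_trans (inc (inr i) (inr i') (L + tau)%N _ _); first last.
  - move=> t tt; have [tL|tL] := ltnP t L; first by rewrite !zr.
    rewrite -(subnKC tL) !zr'; apply: ler_wpM2l; [exact: ltW|apply: le_w].
    by rewrite ltn_subLR.
  - by rewrite leq_add2l.
  - rewrite (split_sum _ (fun t => r (inr i') t * (z (inr i) t - z (inr i') t))); cbv beta; rewrite [X in _ <= X + _]big1 ?add0r => [|t _]; last by rewrite !zr// subrr mulr0.
    apply: ler_sum => t _; rewrite !zr'; lra.
pose X := \sum_i p i * U (inl i).
pose Y := \sum_j p' j * \sum_(t < L) r (inr j) t * mu t.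
(* Every fast type can follow any slow contract through the first block and leave. *)
have XY : (1 - th) * Y <= X.
  have -> : X = \sum_j p' j * X by rewrite -mulr_suml p'1 mul1r.
  rewrite mulr_sumr; apply: ler_sum => j _.
  rewrite mulrCA; apply: ler_wpM2l; first by case: (p'0 j).
  rewrite mulr_sumr.
  rewrite (eq_bigr (fun t : 'I_L => \sum_i p i * ((1 - th) * (r (inr j) t * v i t)))).
    rewrite exchange_big /=; apply: ler_sum => i _; rewrite -mulr_sumr.
    apply: ler_wpM2l; first by case: (p0 i).
    apply: le_trans (inc (inl i) (inr j) L (leq_addr _ _) _); last first.
      move=> t tL; rewrite zl// zr// lerDl; apply: mulr_ge0; first exact: ltW.
      by case: (vh i t) => /andP[].
    apply: ler_sum => t _; rewrite zl// zr//; lra.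
  move=> t _; rewrite /mu !mulr_sumr; apply: eq_bigr => i _; ring.
have M1 : \sum_i p i * (\sum_(t < L) r (inl i) t * mu t) <= 1.
  rewrite -[leRHS]p1; apply: ler_sum => i _.
  rewrite ler_piMr//; first by case: (p0 i).
  rewrite -[leRHS]mu1; apply: ler_sum => t _; rewrite ler_piMl//.
    by case/andP: (muh t).
  by case/andP: (r01 (inl i) t).
(* For fast types the penalty splits: [nu] goes to the first game, and [kap * X] remains to pay for
   the slow block welfare [th * Y]. *)
have -> : \sum_k pz k * (\sum_(t < L + M) r k t * z k t - (nu + kap) * U k) =
  q * (th * (\sum_i p i * (\sum_(t < L) r (inl i) t * mu t)) + (1 - th) *
   (\sum_i p i * (\sum_(t < L) r (inl i) t * v i t
      - nu * (U (inl i) / (1 - th)))) - kap * X)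
  + (1 - q) * (th * Y + (1 - th) *
   (\sum_j p' j * (\sum_(t < M) r (inr j) (L + t)%N * w j t
      - (nu + kap) * (U (inr j) / (1 - th))))).
  rewrite big_sumType /=; congr (_ + _).
    rewrite /X !mulr_sumr -big_split /= -sumrB mulr_sumr; apply: eq_bigr => i _.
    rewrite (split_sum _ (fun t => r (inl i) t * z (inl i) t)); cbv beta; rewrite [X in _ * (_ + X - _) = _]big1 => [|t _]; last first.
      by rewrite zl' mulr0.
    have -> : \sum_(t < L) r (inl i) t * z (inl i) t =
        th * (\sum_(t < L) r (inl i) t * mu t) + (1 - th) *
        \sum_(t < L) r (inl i) t * v i t.
      rewrite !mulr_sumr -big_split; apply: eq_bigr => t _; rewrite zl//=; ring.
    by field; rewrite gt_eqF.
  rewrite /Y !mulr_sumr -big_split /= mulr_sumr; apply: eq_bigr => j _.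
  rewrite (split_sum _ (fun t => r (inr j) t * z (inr j) t)); cbv beta.
  have -> : \sum_(t < L) r (inr j) t * z (inr j) t =
      th * (\sum_(t < L) r (inr j) t * mu t).
    by rewrite mulr_sumr; apply: eq_bigr => t _; rewrite zr//=; ring.
  have -> : \sum_(t < M) r (inr j) (L + t)%N * z (inr j) (L + t)%N =
      (1 - th) * (\sum_(t < M) r (inr j) (L + t)%N * w j t).
    by rewrite mulr_sumr; apply: eq_bigr => t _; rewrite zr'; ring.
  by field; rewrite gt_eqF.
set SA' := \sum_i p i * _ in SA *; set SB' := \sum_j p' j * _ in SB *.
set M' := \sum_i _ in M1 *.
have H1 : 0 <= q * (th * (1 - M')) by rewrite !mulr_ge0 ?subr_ge0 ?(ltW th0).
have H2 : 0 <= q * ((1 - th) * (a - SA')).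
  by rewrite !mulr_ge0 ?(ltW th'0) ?subr_ge0.
have H3 : 0 <= (1 - q) * ((1 - th) * (b - SB')).
  by rewrite !mulr_ge0 ?(ltW th'0) ?subr_ge0.
have H4 : 0 <= kap * q * (X - (1 - th) * Y) by rewrite !mulr_ge0 ?subr_ge0.
have H5 : (1 - q) * th * Y = kap * q * (1 - th) * Y by rewrite eq_marginal.
lra.
Qed.

(** * The recursion for the infimum and its limit *)

Definition beta h nu := inf [set b | achieved h nu b].

Lemma has_inf_achieved h nu b :
  achieved h nu b -> has_inf [set b | achieved h nu b].
Proof. by move=> hb; split; [exists b|exists 0 => ? /achieved_ge0]. Qed.

Lemma beta_step_rat h nu kap a0 th : 0 <= h -> 0 < kap -> rational kap ->
  0 < th < 1 -> rational th -> achieved h nu a0 ->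
  beta h (nu + kap) * (1 + kap * (1 - th)) <= th + (1 - th) * beta h nu.
Proof.
move=> h0 k0 rk th01 rth ha0; have /andP[th0 th1] := th01.
have infA := has_inf_achieved _ _ _ ha0.
have infB := has_inf_achieved _ _ _ (achieved_weaken _ _ _ _ (ltW k0) ha0).
have th'0 : 0 < 1 - th by rewrite subr_gt0.
have rth' : rational (1 - th).
  by apply: rationalD; [exact: (rational_nat 1)|exact: rationalN].
set b := beta _ (nu + kap); set a := beta _ nu.
(* [q = th / D] is the solution of the balance equation [marg]. *)
pose D := th + kap * (1 - th); have D0 : 0 < D by rewrite addr_gt0// mulr_gt0.
pose q := th / D; have qD : q * D = th by rewrite divfK// gt_eqF.
have q0 : 0 < q by rewrite divr_gt0.
have q1 : q <= 1 by rewrite ler_pdivrMr// mul1r lerDl mulr_ge0// ltW.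
have rq : rational q.
  apply: rationalM => //; apply: rationalV; apply: rationalD => //.
  exact: rationalM.
have marg : (1 - q) * th = kap * q * (1 - th).
  by rewrite /D in qD; lra.
have main : b <= q * (th + (1 - th) * a) + (1 - q) * ((1 - th) * b).
  apply/ler_addgt0Pr => e e0.
  have [a' ha' a'e] := inf_adherent e0 infA.
  have [b' hb' b'e] := inf_adherent e0 infB.
  have {}a'e : a' <= a + e := ltW a'e.
  have {}b'e : b' <= b + e := ltW b'e.
  have q01 : 0 <= q <= 1 by rewrite ltW.
  have := achieved_step _ _ _ _ _ _ _ h0 (ltW k0) th01 q01 rth rq marg ha' hb'.
  move=> /(ge_inf infB.2); rewrite -/(beta h (nu + kap)) -/b => /le_trans; apply.
  have H1 : 0 <= q * ((1 - th) * (a + e - a')).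
    apply: mulr_ge0; first exact: ltW.
    by apply: mulr_ge0; [exact: ltW|rewrite subr_ge0].
  have H2 : 0 <= (1 - q) * ((1 - th) * (b + e - b')).
    apply: mulr_ge0; first by rewrite subr_ge0.
    by apply: mulr_ge0; [exact: ltW|rewrite subr_ge0].
  have H3 : 0 <= th * e by rewrite mulr_ge0// ltW.
  lra.
(* The coefficient of [b], moved to the left, is [1 - (1 - q) * (1 - th) = th + q * (1 - th)], which
   is [q * (1 + kap * (1 - th))] by [qD]. *)
have : q * (b * (1 + kap * (1 - th))) <= q * (th + (1 - th) * a).
  have : b * (q * D) = b * th by rewrite qD.
  by rewrite /D; lra.
by rewrite ler_pM2l.
Qed.

Lemma beta_step h nu kap a0 : 0 <= h -> 0 < kap -> rational kap ->
  achieved h nu a0 -> beta h (nu + kap) * (1 + kap) <= beta h nu.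
Proof.
move=> h0 k0 rk ha0.
have infA := has_inf_achieved _ _ _ ha0.
have infB := has_inf_achieved _ _ _ (achieved_weaken _ _ _ _ (ltW k0) ha0).
have a_ge0 : 0 <= beta h nu.
  by apply: lb_le_inf infA.1 _ => x; exact: achieved_ge0.
have b_ge0 : 0 <= beta h (nu + kap).
  by apply: lb_le_inf infB.1 _ => x; exact: achieved_ge0.
apply/ler_addgt0Pr => e e0.
have D0 : 0 < 1 + kap * beta h (nu + kap).
  by rewrite ltr_pwDl// mulr_ge0// ltW.
(* A rational [th] below this bound makes the error [th * (1 + kap * beta h (nu + kap))] less than
   [e]. *)
have m0 : 0 < Num.min (1 : R) (e / (1 + kap * beta h (nu + kap))).
  by rewrite lt_min ltr01 divr_gt0.
have [q] := rat_in_itvoo m0; rewrite in_itv/= lt_min => /and3P[q0 q1 qe].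
have := beta_step_rat _ _ _ _ (ratr q) h0 k0 rk _ (rational_rat q) ha0.
rewrite q0 q1 => /(_ isT).
rewrite ltr_pdivlMr// in qe.
have : 0 <= ratr q * beta h nu by rewrite mulr_ge0// ltW.
lra.
Qed.

(** [N.+1] steps of size [k = 1 / N.+1] lead from [nu = 0] to [nu = 1], each dividing the bound by
    [1 + k]. *)
Lemma beta_le_exp h (N n : nat) : n.+1%:R^-1 <= h ->
  beta h 1 <= (1 + N.+1%:R^-1) ^- N.+1.
Proof.
move=> nh; have h0 : 0 <= h by apply: le_trans nh; rewrite invr_ge0.
pose k : R := N.+1%:R^-1; have k0 : 0 < k by rewrite invr_gt0.
have rk : rational k by exact/rationalV/rational_nat.
have ach m : achieved h (m%:R * k) 1.
  rewrite -[_ * _]add0r; apply: achieved_weaken; last exact: achieved_base nh.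
  by rewrite mulr_ge0// ltW.
have H m : beta h (m%:R * k) <= (1 + k) ^- m.
  elim: m => [|m IHm].
    have := ge_inf (has_inf_achieved _ _ _ (ach 0)).2 (ach 0).
    by rewrite expr0 invr1.
  rewrite exprSr invfM ler_pdivlMr ?addr_gt0//; apply: le_trans IHm.
  rewrite -natr1 mulrDl mul1r; exact: beta_step (ach m).
by have := H N.+1; rewrite /k mulfV ?pnatr_eq0.
Qed.

Lemma achieved_inv_e h c (n : nat) : n.+1%:R^-1 <= h -> (expR 1)^-1 < c ->
  exists2 b, b < c & achieved h 1 b.
Proof.
move=> nh ec; have e0 : 0 < (expR 1 : R) by exact: expR_gt0.
have c0 : 0 < c by apply: lt_trans ec; rewrite invr_gt0.
have [N Nc] : exists N : nat, (1 + N.+1%:R^-1) ^- N.+1 < c.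
  have ce : 0 < c * expR 1 - 1 by rewrite subr_gt0 -ltr_pdivrMr ?div1r.
  (* This gives [1 + x < c * expR 1] for [x = 1 / N.+1]. As [expR 1 <= (1 + x) ^+ N.+2], one extra
     factor [1 + x] suffices. *)
  pose N := Num.bound (c * expR 1 - 1)^-1; exists N.
  pose x : R := N.+1%:R^-1; have x0 : 0 < x by rewrite invr_gt0.
  have D0 : 0 < 1 + x by rewrite addr_gt0.
  have xN : N.+2%:R^-1 = 1 - (1 + x)^-1.
    have y0 : 0 < N.+1%:R :> R by [].
    by rewrite -(natr1 N.+1) /x; field; rewrite !gt_eqF ?addr_gt0.
  have e_le : expR 1 <= (1 + x) ^+ N.+2.
    have -> : expR 1 = expR N.+2%:R^-1 ^+ N.+2 :> R.
      by rewrite -expRM_natl mulfV// pnatr_eq0.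
    apply: lerXn2r; rewrite ?nnegrE ?expR_ge0 ?(ltW D0)//.
    (* This is [1 - y <= expR (- y)] at [y = 1 / N.+2]. *)
    have le_inv : (1 + x)^-1 <= (expR N.+2%:R^-1)^-1.
      by rewrite -expRN xN opprB; apply: le_trans (expR_ge1Dx _); rewrite subrKC.
    by move: le_inv; rewrite lef_pV2 ?posrE ?expR_gt0.
  rewrite -/x -div1r ltr_pdivrMr ?exprn_gt0//.
  rewrite -(ltr_pM2r D0) -mulrA -exprSr mul1r.
  apply: (@lt_le_trans _ _ (c * expR 1)); last by rewrite ler_wpM2l// ltW.
  rewrite -ltrBrDl /x -[ltRHS]invrK ltf_pV2 ?posrE ?invr_gt0//.
  by apply: lt_le_trans (archi_boundP _) _; rewrite ?invr_ge0 ?ler_nat// ltW.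
have ach : achieved h 1 1.
  by have := achieved_weaken h 0 1 1 ler01 (achieved_base h n nh); rewrite add0r.
have eps0 : 0 < c - beta h 1.
  by rewrite subr_gt0; apply: le_lt_trans Nc; exact: beta_le_exp nh.
have [b hb bc] := inf_adherent eps0 (has_inf_achieved h 1 1 ach).
by exists b => //; rewrite /beta subrKC in bc.
Qed.

End HardGames.

(** * Clearing denominators, and averaging over protocols *)

Lemma common_denominator (R : realType) (J : finType) (F : J -> R) :
  (forall j, 0 <= F j) -> (forall j, rational (F j)) ->
  exists2 Q : nat, (0 < Q)%N & exists k : J -> nat, forall j, F j * Q%:R = (k j)%:R.
Proof.
move=> F0 rF; have exq j : exists q, F j = ratr q by have [q _ <-] := rF j; exists q.
have [q qE] := boolp.choice exq.
exists (\prod_j `|denq (q j)|)%N.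
  by rewrite prodn_gt0// => j; rewrite absz_gt0 denq_neq0.
exists (fun j => `|numq (q j)| * \prod_(i | i != j) `|denq (q i)|)%N => j.
rewrite (bigD1 j)//= !natrM mulrA; congr (_ * _).
have nq0 : 0 <= numq (q j) by rewrite numq_ge0 -(ler0q R) -qE.
rewrite !natr_absz (ger0_norm nq0) (gtr0_norm (denq_gt0 _)) qE.
by rewrite -[X in ratr X]divq_num_den fmorph_div/= !ratr_int divfK// intr_eq0 denq_neq0.
Qed.

Lemma esumZ (R : realType) (S : choiceType) (A : set S) (a : S -> \bar R) (c : R) :
  0 <= c -> (forall s, 0 <= a s)%E ->
  (\esum_(s in A) (c%:E * a s) = c%:E * \esum_(s in A) a s)%E.
Proof.
move=> c0 a0.
have le_esumZ (k : R) (g : S -> \bar R) : 0 <= k -> (forall s, 0 <= g s)%E ->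
    (\esum_(s in A) (k%:E * g s) <= k%:E * \esum_(s in A) g s)%E.
  move=> k0 g0; apply: ge_ereal_sup => _ [X [finX XA] <-].
  rewrite -ge0_mule_fsumr//; apply: lee_wpmul2l; first by rewrite lee_fin.
  by apply: esum_ge; exists X.
apply/eqP; rewrite eq_le le_esumZ//=.
have [->|cN0] := eqVneq c 0.
  by rewrite mul0e; apply: esum_ge0 => s _; rewrite mul0e.
have {cN0}c0' : 0 < c by rewrite lt0r cN0.
have cV0 : 0 <= c^-1 by rewrite invr_ge0.
(* The reverse inequality is the same bound for the scalar [c^-1]. *)
have := le_esumZ c^-1 (fun s => c%:E * a s)%E cV0.
move=> /(_ (fun s => mule_ge0 (c0 : (0 <= c%:E)%E) (a0 s))).
under eq_esum do rewrite muleA -EFinM mulVf ?gt_eqF// mul1e.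
by rewrite lee_pdivlMl.
Qed.

(* Yao's principle *)
Lemma exists_low_expectation (R : realType) (S : choiceType) (I : finType)
    (p : S -> R) (w : I -> R) (f : I -> S -> R) (K K' : R) :
  (forall s, 0 <= p s) -> (\esum_(s in [set: S]) (p s)%:E = 1)%E ->
  (forall i, 0 <= w i) -> \sum_i w i = 1 -> 0 <= K' -> K' < K ->
  (forall s, p s != 0 -> \sum_i w i * f i s <= K') ->
  exists i, (\esum_(s in [set: S]) (Num.max (p s * f i s) 0)%:E
    - \esum_(s in [set: S]) (Num.max (- (p s * f i s)) 0)%:E <= K%:E)%E.
Proof.
move=> p0 p1 w0 w1 K'0 K'K le_avg; apply: contrapT => /forallNP gtK.
pose P i := (\esum_(s in [set: S]) (Num.max (p s * f i s) 0)%:E)%E.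
pose N i := (\esum_(s in [set: S]) (Num.max (- (p s * f i s)) 0)%:E)%E.
have max0 (x : R) : 0 <= Num.max x 0 by rewrite le_max lexx orbT.
have max0E (x : R) : (0 <= (Num.max x 0)%:E)%E by rewrite lee_fin.
have N0 i : (0 <= N i)%E by apply: esum_ge0 => s _.
have {}gtK i : (K%:E < P i - N i)%E.
  by rewrite ltNge; apply/negP; exact: gtK.
(* An infinite [N i] would make the difference [-oo], even if [P i] is infinite, against [gtK]. *)
have NK i : (N i + K%:E <= P i)%E /\ N i \is a fin_num.
  have := gtK i; have := N0 i; case: (N i) => [n| |] // _.
    by move=> /ltW; rewrite leeBrDr// addeC; split.
  by case: (P i).
(* Keeping both parts as nonnegative sums avoids any convergence question; the inequality then holds
   termwise in [s]. *)
have : (\sum_i ((w i)%:E * P i) <= \sum_i ((w i)%:E * N i) + K'%:E)%E.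
  have EZ (g : I -> S -> R) :
    (\sum_i ((w i)%:E * (\esum_(s in [set: S]) (Num.max (g i s) 0)%:E)) =
     \esum_(s in [set: S]) (\sum_i (w i * Num.max (g i s) 0)%R)%R%:E)%E.
    under eq_bigr do rewrite -esumZ//.
    rewrite -esum_sum; last by move=> s i _ _; rewrite mule_ge0// lee_fin.
    by apply: eq_esum => s _; rewrite -sumEFin.
  rewrite /P /N !EZ -[K'%:E]mule1 -p1 -esumZ//.
  rewrite -esumD; first last.
  - by move=> s _; rewrite -EFinM lee_fin mulr_ge0.
  - by move=> s _; rewrite lee_fin sumr_ge0// => i _; rewrite mulr_ge0.
  apply: le_esum => s _; rewrite -EFinM -EFinD lee_fin -lerBlDl -sumrB.
  have -> : \sum_i (w i * Num.max (p s * f i s) 0 - w i * Num.max (- (p s * f i s)) 0)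
      = p s * \sum_i w i * f i s.
    rewrite mulr_sumr; apply: eq_bigr => i _; rewrite -mulrBr.
    rewrite mulrCA; congr (_ * _).
    by rewrite !maxEle oppr_le0; case: (lerP (p s * f i s) 0);
      case: (lerP 0 (p s * f i s)); lra.
  have [->|ps] := eqVneq (p s) 0; first by rewrite mul0r mulr0.
  by rewrite mulrC; apply: ler_wpM2r => //; exact: le_avg.
apply/negP; rewrite -ltNge.
apply: (@lt_le_trans _ _ (\sum_i ((w i)%:E * (N i + K%:E)))%E); last first.
  by apply: lee_sum => i _; apply: lee_wpmul2l; [rewrite lee_fin|case: (NK i)].
have Nf i : N i = (fine (N i))%:E by rewrite fineK//; case: (NK i).
rewrite (eq_bigr (fun i => (w i * fine (N i))%:E)); last first.
  by move=> i _; rewrite {1}Nf.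
rewrite [ltRHS](eq_bigr (fun i => (w i * (fine (N i) + K))%:E)); last first.
  by move=> i _; rewrite {1}Nf.
rewrite !sumEFin -EFinD lte_fin.
under [ltRHS]eq_bigr do rewrite mulrDr.
by rewrite big_split /= ltrD2l -mulr_suml w1 mul1r.
Qed.

(** * From truthful protocols to the normalised game *)

Lemma truthful_avg_revenue (R : realType) (T : nat) (V b : R) (I : finType)
    (L : nat) (w : I -> R) (v : I -> nat -> R) (ty : I -> Ty T V)
    (pi : Proto T V) :
  (L < T)%N -> 0 < V -> (forall i, 0 <= w i) -> \sum_i w i = 1 ->
  (forall i (t : 'I_T), val_t (ty i) t = if (t < L)%N then V * v i t else 0) ->
  hard I L w v 1 b -> truthful pi ->
  \sum_i w i * Rev pi (ty i) <= b * V + 20 * epsT R T * T%:R.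
Proof.
case: T ty pi => // T ty pi; set e := epsT R T.+1 => LT V0 w0 w1 tyE hd [al01 [pr_le dev]].
have e0 : 0 <= e by rewrite invr_ge0 exprn_ge0.
pose util i := \sum_t (alloc pi (ty i) t * val_t (ty i) t - price pi (ty i) t)
  + reimb pi (ty i).
(* One [10 * e * T.+1%:R] covers the slack of truthfulness, the other the excess of prices over
   [r_j v_j], summed over rounds. *)
pose U i := (util i + 20 * e * T.+1%:R) / V.
pose r i t := alloc pi (ty i) (inord t).
have sumE tau (F : nat -> R) : (tau <= L)%N ->
    \sum_(t < tau) F t = \sum_(t < T.+1 | (t < tau)%N) F t.
  by move=> tauL; rewrite (big_ord_widen T.+1)// (leq_trans tauL)// ltnW.
have inc : incentive I L v r U.
  move=> i j tau tauL le_v; rewrite /U ler_pdivlMr//.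
  (* The deviation stops before the last round, so it collects no reimbursement. *)
  have tauT : (tau < T.+1)%N := leq_ltn_trans tauL LT.
  have le_val (t : 'I_T.+1) : (t < tau)%N -> val_t (ty j) t <= val_t (ty i) t.
    by move=> tt; rewrite !tyE (leq_trans tt tauL) ler_pM2l// le_v.
  have := dev (ty i) (ty j) tau (ltnW tauT).
  rewrite (ltn_eqF tauT) addr0 -/(util i) => /(_ _)/le_trans-/(_ _ _) H.
  have {}H : \sum_(t < T.+1 | (t < tau)%N)
      (alloc pi (ty j) t * val_t (ty i) t - price pi (ty j) t)
      - 10 * e * T.+1%:R <= util i.
    apply: H => // t tt; apply: le_trans (pr_le _ _) _; rewrite lerD2r.
    by apply: ler_wpM2l; [case/andP: (al01 (ty j) t)|exact: le_val].
  rewrite -lerBlDr; apply: le_trans H.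
  have -> : 20 * e * T.+1%:R = 10 * e * T.+1%:R + 10 * e * T.+1%:R by ring.
  rewrite opprD addrA lerD2r lerBlDr.
  have cardT : \sum_(t < T.+1 | (t < tau)%N) 10 * e <= 10 * e * T.+1%:R.
    rewrite sumr_const -[leLHS]mulr_natr; apply: ler_wpM2l; first by rewrite mulr_ge0.
    by rewrite ler_nat (leq_trans (max_card _))// card_ord.
  apply: le_trans (lerD (lexx _) cardT).
  rewrite -big_split/= (sumE _ (fun t => r j t * (v i t - v j t)))// mulr_suml; apply: ler_sum => t tt.
  rewrite /r inord_val.
  have := pr_le (ty j) t; have := tyE j t; have := tyE i t.
  rewrite (leq_trans tt tauL) => -> ->; rewrite -/e; lra.
have := hd r U _ inc.
have r01 i t : 0 <= r i t <= 1 by exact: al01.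
move=> /(_ r01); rewrite -(ler_pM2r V0) => /(lerD) /(_ (lexx (20 * e * T.+1%:R))).
apply: le_trans; rewrite le_eqVlt; apply/orP; left; apply/eqP.
have -> : 20 * e * T.+1%:R = \sum_i w i * (20 * e * T.+1%:R).
  by rewrite -mulr_suml w1 mul1r.
rewrite mulr_suml -big_split/=; apply: eq_bigr => i _.
have -> : \sum_(t < L) r i t * v i t =
    (\sum_t alloc pi (ty i) t * val_t (ty i) t) / V.
  rewrite (sumE L (fun t => r i t * v i t))// big_mkcond/= mulr_suml; apply: eq_bigr => t _.
  rewrite tyE /r inord_val; case: ifP => _; last by rewrite mulr0 mul0r.
  by field; rewrite gt_eqF.
rewrite /Rev /U /util sumrB; field; by rewrite gt_eqF.
Qed.

(** * Rescaling a fixed game to the grid *)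

Theorem theorem22 (R : realType) (c d : R) :
  (expR 1)^-1 < c -> 0 <= d ->
  exists T0 : nat, forall T : nat, (T0 <= T)%N ->
    exists V : R, forall p : @Proto R T V -> R, is_distr p ->
      exists v : @Ty R T V, (ExpRev p v <= (c * V - d)%:E)%E.
Proof.
move=> ec d0; pose c' := (c + (expR 1)^-1) / 2.
have ec' : (expR 1)^-1 < c' by rewrite /c'; lra.
have c'c : 0 < c - c' by rewrite /c'; lra.
(* The margin [(c - c') * X] pays for [d] and for the discretisation error, which is at most 1. *)
pose X := (Num.bound ((d + 1) / (c - c'))).+1.
have XP : d + 1 <= (c - c') * X%:R.
  rewrite mulrC -ler_pdivrMr//; apply/ltW/(lt_le_trans (archi_boundP _)).
    by apply: divr_ge0; [rewrite addr_ge0|exact: ltW].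
  by rewrite ler_nat.
pose n := (2 * X).-1; have nX : n.+1 = (2 * X)%N by rewrite prednK.
have [b bc'] := achieved_inv_e _ c' n (lexx (n.+1%:R^-1)) ec'.
move=> ach; have b0 := achieved_ge0 _ _ _ ach.
case: ach => I [L [w [v [[w0 w1 vh v1] hd]]]].
have [Q Q0 [k kE]] : exists2 Q : nat, (0 < Q)%N & exists k : I * 'I_L -> nat,
    forall j : I * 'I_L, v j.1 j.2 * Q%:R = (k j)%:R.
  apply: (common_denominator _ _ (fun j : I * 'I_L => v j.1 j.2)) => j.
    by case: (vh j.1 j.2) => /andP[].
  by case: (vh j.1 j.2).
(* [20] gives [20 * T <= N], [L.+1] leaves a round after the game, and [Q] gives [Q <= N]. *)
exists (maxn 20 (maxn L.+1 Q)) => T; rewrite !geq_max => /and3P[T20 LT QT].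
have T0 : (0 < T)%N by exact: leq_trans T20.
pose N := Ngrid T.
have epsE : epsT R T = N%:R^-1 by rewrite /epsT /N /Ngrid natrX.
have TN : (20 * T <= N)%N.
  apply: (@leq_trans (T ^ 2)); first by rewrite -mulnn leq_mul2r T20 orbT.
  by rewrite leq_pexp2l.
have N0 : (0 < N)%N by rewrite (leq_trans _ TN)// muln_gt0.
have N0' : 0 < N%:R :> R by rewrite ltr0n.
(* Then [V = m * Q / N] lies between [X] and [2 * X]: the rescaled values [m * k (i, t) / N] are on
   the grid, and at most 1 since the profiles are bounded by [1 / (2 * X)]. *)
pose m := ((X * N) %/ Q).+1.
have XQm : (X * N <= m * Q)%N by rewrite ltnW// ltn_ceil.
have QmX : (m * Q <= 2 * (X * N))%N.
  have -> : (m * Q = Q + (X * N) %/ Q * Q)%N by exact: mulSn.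
  rewrite mul2n -addnn leq_add ?leq_divM//.
  apply: (leq_trans QT); apply: (@leq_trans N); last by rewrite leq_pmull.
  by rewrite (leq_trans _ TN)// leq_pmull.
pose V : R := (m * Q)%:R * epsT R T; exists V => p [p0 [ptr p1]].
have VX : X%:R <= V.
  by rewrite /V epsE ler_pdivlMr// -natrM ler_nat.
have V0 : 0 < V by apply: lt_le_trans VX; rewrite ltr0n.
have kN i t : (m * k (i, t) <= N)%N.
  have [/andP[_ vn] _] := vh i t.
  rewrite -(leq_pmul2l (isT : (0 < 2 * X)%N)).
  apply: (@leq_trans (m * Q)); last by rewrite -mulnA.
  rewrite mulnCA leq_mul2l; apply/orP; right.
  rewrite -(ler_nat R) natrM -kE/= mulrA ler_piMl// -nX mulrC.
  by rewrite -ler_pdivlMr// div1r.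
have exty : forall i, exists y : Ty T V, forall t : 'I_T,
    val_t y t = if (t < L)%N then V * v i t else 0.
  move=> i.
  pose f := [ffun t : 'I_T => (inord (if insub (val t) is Some u
    then m * k (i, u) else 0)%N : 'I_(Ngrid T).+1)].
  have fE t : (val (f t))%:R * epsT R T = if (t < L)%N then V * v i t else 0.
    rewrite ffunE; case: insubP => [u tL ut|/negPf ->]; last first.
      by rewrite [X in X%:R]inordK// mul0r.
    rewrite tL [X in X%:R]inordK; last by rewrite ltnS kN.
    by rewrite natrM -kE/= ut /V natrM; ring.
  have fV : \sum_(t < T) (val (f t))%:R * epsT R T == V.
    under eq_bigr do rewrite fE.
    rewrite -big_mkcond/= -(big_ord_widen T (fun t => V * v i t))/=; last exact: ltnW.
    by rewrite -mulr_sumr v1 mulr1.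
  by exists (exist _ f fV) => t; exact: fE.
have [ty tyE] := boolp.choice exty.
have K'0 : 0 <= b * V + 20 * epsT R T * T%:R.
  by rewrite epsE addr_ge0 ?mulr_ge0 ?invr_ge0 ?(ltW V0).
have K'K : b * V + 20 * epsT R T * T%:R < c * V - d.
  have small : 20 * epsT R T * T%:R <= 1.
    by rewrite epsE mulrAC ler_pdivrMr// mul1r -natrM ler_nat.
  have H1 : (c - c') * X%:R <= (c - c') * V by rewrite ler_pM2l.
  have H2 : b * V < c' * V by rewrite ltr_pM2r.
  lra.
have avg pi : p pi != 0 ->
    \sum_i w i * Rev pi (ty i) <= b * V + 20 * epsT R T * T%:R.
  move=> /ptr tr.
  by apply: truthful_avg_revenue LT V0 _ w1 tyE hd tr => i; case: (w0 i).
have [i] := exists_low_expectation R (Proto T V) I p w (fun i pi => Rev pi (ty i))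
  _ _ p0 p1 (fun i => (w0 i).1) w1 K'0 K'K avg.
by exists (ty i).
Qed.
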